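(* Let $\mathcal C,\mathcal D$ be $K$-linear 2-categories and $\mathcal F=(|\mathcal F|,\mathcal F_*,\widehat{\mathcal F}_* ):\mathcal C\to\mathcal D$ a $K$-linear unitary pseudofunctor. Then the equivalence classes of purely pseudofunctorial first order deformations of $\mathcal F$ are in bijection with the elements of $H^2(\mathcal F)$.
   Context: Conventions. $K$ is a commutative ring with unit. 2-categories are strict; $id_X$, $1_f$ are identity 1- and 2-morphisms, $\sigma\cdot\tau$ is vertical composition (first $\tau$), $\circ$ is composition of 1-morphisms ($g\circ f$: first $f$) and horizontal composition of 2-morphisms. A 2-category is $K$-linear if sets of 2-morphisms are $K$-modules and vertical and horizontal composition are $K$-bilinear. Pseudofunctors. A pseudofunctor $\mathcal F:\mathcal C\to\mathcal D$ between 2-categories consists of an object map, functors $\mathcal F_{X,Y}:\mathcal C(X,Y)\to\mathcal D(\mathcal F(X),\mathcal F(Y))$, 2-isomorphisms $\widehat{\mathcal F}(g,f):\mathcal F(g)\circ\mathcal F(f)\Rightarrow\mathcal F(g\circ f)$ natural in $(f,g)$, and 2-isomorphisms $\mathcal F_0(X):\mathcal F(id_X)\Rightarrow id_{\mathcal F(X)}$, with $\widehat{\mathcal F}(h,g\circ f)\cdot(1_{\mathcal F(h)}\circ\widehat{\mathcal F}(g,f))=\widehat{\mathcal F}(h\circ g,f)\cdot(\widehat{\mathcal F}(h,g)\circ1_{\mathcal F(f)})$, $\widehat{\mathcal F}(f,id_X)=1_{\mathcal F(f)}\circ\mathcal F_0(X)$ and $\widehat{\mathcal F}(id_Y,f)=\mathcal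 F_0(Y)\circ1_{\mathcal F(f)}$. It is unitary if all $\mathcal F_0(X)$ are identities, and $K$-linear if all $\mathcal F_{X,Y}$ are $K$-linear on 2-morphisms. A pseudonatural transformation $\xi:\mathcal F\Rightarrow\mathcal G$ has 1-morphisms $\xi_X:\mathcal F(X)\to\mathcal G(X)$ and 2-isomorphisms $\widehat\xi(f):\mathcal G(f)\circ\xi_X\Rightarrow\xi_Y\circ\mathcal F(f)$ natural in $f$ with $\widehat\xi(g\circ f)\cdot(\widehat{\mathcal G}(g,f)\circ1_{\xi_X})=(1_{\xi_Z}\circ\widehat{\mathcal F}(g,f))\cdot(\widehat\xi(g)\circ1_{\mathcal F(f)})\cdot(1_{\mathcal G(g)}\circ\widehat\xi(f))$ and $(1_{\xi_X}\circ\mathcal F_0(X))\cdot\widehat\xi(id_X)=\mathcal G_0(X)\circ1_{\xi_X}$. Deformations. For a $K$-linear 2-category $\mathcal C$, $\mathcal C_\epsilon$ has the same objects and 1-morphisms, and 2-morphisms $\tau_0+\tau_1\epsilon$ ($\epsilon^2=0$), with compositions extended $K[\epsilon]/(\epsilon^2)$-bilinearly. A purely pseudofunctorial first order deformation of $\mathcal F$ is a pseudofunctor $\mathcal F_\epsilon:\mathcal C_\epsilon\to\mathcal D_\epsilon$ with the same object map and the same action on 1-morphisms as $\mathcal F$, acting on 2-morphisms by the $K[\epsilon]/(\epsilon^2)$-linear extension of $\mathcal F$, and whose structural 2-isomorphisms have the form $\widehat{\mathcal F}_\epsilon(g,f)=\widehat{\mathcal F}(g,f)+\widehat{\mathcal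 F}^{(1)}(g,f)\epsilon$, $(\mathcal F_0)_\epsilon(X)=\mathcal F_0(X)+\mathcal F_0^{(1)}(X)\epsilon$ (it need not be unitary). Two such deformations $\mathcal F_\epsilon,\mathcal F'_\epsilon$ are equivalent if there is a pseudonatural isomorphism $\xi:\mathcal F_\epsilon\Rightarrow\mathcal F'_\epsilon$ with $\xi_X=id_{\mathcal F(X)}$ for all $X$ and $\widehat\xi(f)\equiv1_{\mathcal F(f)}$ mod $\epsilon$ for all $f$. Complex. For $n\ge1$, $X^n(\mathcal F)$ is the $K$-module of families $\phi$ of 2-morphisms $\phi(f_0,\dots,f_{n-1}):\mathcal F(f_0)\circ\cdots\circ\mathcal F(f_{n-1})\Rightarrow\mathcal F(f_0\circ\cdots\circ f_{n-1})$, one for each composable sequence of 1-morphisms of $\mathcal C$ ($f_{n-1}$ applied first), natural in $(f_0,\dots,f_{n-1})$ with respect to 2-morphisms; $X^n(\mathcal F)=0$ for $n\le0$. For $n\ge2$, $\delta:X^{n-1}(\mathcal F)\to X^n(\mathcal F)$ is $$(\delta\phi)(f_0,\dots,f_{n-1})=\widehat{\mathcal F}(f_0,f_1\circ\cdots\circ f_{n-1})\cdot(1_{\mathcal F(f_0)}\circ\phi(f_1,\dots,f_{n-1}))+\sum_{i=1}^{n-1}(-1)^i\phi(f_0,\dots,f_{i-1}\circ f_i,\dots,f_{n-1})\cdot(1\circ\widehat{\mathcal F}(f_{i-1},f_i)\circ1)+(-1)^n\widehat{\mathcal F}(f_0\circ\cdots\circ f_{n-2},f_{n-1})\cdot(\phi(f_0,\dots,f_{n-2})\circ1_{\mathcal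 F(f_{n-1})}),$$ the outer $1$'s being identities of the remaining $\mathcal F(f_j)$'s. $H^\bullet(\mathcal F)$ is the cohomology of $(X^\bullet(\mathcal F),\delta)$. *)

(* Defs.v *)
From HB Require Import structures.
From mathcomp Require Import all_boot all_order all_algebra.
From mathcomp Require Import boolp.

Set Implicit Arguments.
Unset Strict Implicit.
Unset Printing Implicit Defensive.

Import GRing.Theory.
Local Open Scope ring_scope.

Declare Scope twocat_scope.
Local Open Scope twocat_scope.

Reserved Notation "g \c f" (at level 40, left associativity).
Reserved Notation "s \h t" (at level 40, left associativity).
Reserved Notation "s \v t" (at level 48, left associativity).
Reserved Notation "s ~= t" (at level 70, no associativity).

(* In a strict 2-category two 2-morphisms can be equal although their sources *)
(* (or targets) are only provably, not definitionally, the same 1-morphism.   *)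
(* [s ~= t] is that equality: the sources agree, the targets agree, and s is  *)
(* t after transport along these equalities.                                  *)

Definition cast2 (T : Type) (H : T -> T -> Type) (f f' g g' : T)
    (e : f = f') (e' : g = g') : H f g -> H f' g' :=
  match e in _ = a, e' in _ = b return H f g -> H a b with
  | erefl, erefl => fun s => s
  end.

Definition heq2 (T : Type) (H : T -> T -> Type) (f f' g g' : T)
    (s : H f g) (t : H f' g') : Prop :=
  exists (e : f = f') (e' : g = g'), cast2 e e' s = t.

Notation "s ~= t" := (heq2 s t) : twocat_scope.

Lemma heq2_cast (T : Type) (H : T -> T -> Type) (f f' g g' : T)
    (s : H f g) (t : H f' g') (e : f = f') (e' : g = g') :
  s ~= t -> cast2 e e' s = t.
Proof.
by move=> [d [d' <-]]; rewrite (Prop_irrelevance e d) (Prop_irrelevance e' d').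
Qed.

Lemma heq2_sym (T : Type) (H : T -> T -> Type) (f f' g g' : T)
    (s : H f g) (t : H f' g') : s ~= t -> t ~= s.
Proof.
by case=> e [e' <-]; exists (esym e), (esym e'); case: _ / e; case: _ / e'.
Qed.

Lemma heq2_cast2 (T : Type) (H : T -> T -> Type) (f f' g g' : T)
    (e : f = f') (e' : g = g') (s : H f g) : s ~= cast2 e e' s.
Proof. by exists e, e'. Qed.

Lemma heq2_trans (T : Type) (H : T -> T -> Type) (f f' f'' g g' g'' : T)
    (s : H f g) (t : H f' g') (u : H f'' g'') : s ~= t -> t ~= u -> s ~= u.
Proof.
move=> [e [e' <-]]; case: f' / e t; case: g' / e' => _ [d [d' <-]].
by exists d, d'.
Qed.

Lemma heq2_uniq (T : Type) (H : T -> T -> Type) (f f' g g' : T)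
    (s : H f g) (t t' : H f' g') : s ~= t -> s ~= t' -> t = t'.
Proof. by move=> [e [e' <-]] /(heq2_cast e e'). Qed.

(* Strict 2-categories: [g \c f] is composition of 1-morphisms (first f),     *)
(* [s \v t] vertical composition (first t), [s \h t] horizontal composition.  *)
Record twoCat := TwoCat {
  ob :> Type;
  hom : ob -> ob -> Type;
  hom2 : forall X Y, hom X Y -> hom X Y -> Type;
  id1 : forall X, hom X X;
  comp1 : forall X Y Z, hom Y Z -> hom X Y -> hom X Z
    where "g \c f" := (comp1 g f);
  id2 : forall X Y (f : hom X Y), hom2 f f;
  vcomp : forall X Y (f g h : hom X Y), hom2 g h -> hom2 f g -> hom2 f h
    where "s \v t" := (vcomp s t);
  hcomp : forall X Y Z (g g' : hom Y Z) (f f' : hom X Y),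
    hom2 g g' -> hom2 f f' -> hom2 (g \c f) (g' \c f')
    where "s \h t" := (hcomp s t);
  comp1A : forall W X Y Z (h : hom Y Z) (g : hom X Y) (f : hom W X),
    h \c (g \c f) = (h \c g) \c f;
  comp1l : forall X Y (f : hom X Y), id1 Y \c f = f;
  comp1r : forall X Y (f : hom X Y), f \c id1 X = f;
  vcompA : forall X Y (f g h k : hom X Y)
    (s : hom2 h k) (t : hom2 g h) (u : hom2 f g),
    s \v (t \v u) = (s \v t) \v u;
  vcompl : forall X Y (f g : hom X Y) (s : hom2 f g), id2 g \v s = s;
  vcompr : forall X Y (f g : hom X Y) (s : hom2 f g), s \v id2 f = s;
  hcomp_id2 : forall X Y Z (g : hom Y Z) (f : hom X Y),
    id2 g \h id2 f = id2 (g \c f);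
  interchange : forall X Y Z (g g' g'' : hom Y Z) (f f' f'' : hom X Y)
    (s' : hom2 g' g'') (s : hom2 g g') (t' : hom2 f' f'') (t : hom2 f f'),
    (s' \v s) \h (t' \v t) = (s' \h t') \v (s \h t);
  hcompA : forall W X Y Z (h h' : hom Y Z) (g g' : hom X Y) (f f' : hom W X)
    (s : hom2 h h') (t : hom2 g g') (u : hom2 f f'),
    s \h (t \h u) ~= (s \h t) \h u;
  hcompl : forall X Y (f g : hom X Y) (s : hom2 f g), id2 (id1 Y) \h s ~= s;
  hcompr : forall X Y (f g : hom X Y) (s : hom2 f g), s \h id2 (id1 X) ~= s
}.

Arguments hom {_}.
Arguments hom2 {_ X Y}.
Arguments id1 {_}.
Arguments id2 {_ X Y}.
Arguments comp1A {_ W X Y Z}.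

Notation "g \c f" := (comp1 g f) : twocat_scope.
Notation "s \v t" := (vcomp s t) : twocat_scope.
Notation "s \h t" := (hcomp s t) : twocat_scope.

(* The identity 2-morphism between two equal 1-morphisms. *)
Definition eq2 (C : twoCat) (X Y : C) (f g : hom X Y) (e : f = g) : hom2 f g :=
  cast2 erefl e (id2 f).

Lemma eq2_irr (E : twoCat) (X Y : E) (f g : hom X Y) (e e' : f = g) :
  eq2 e = eq2 e'.
Proof. by rewrite (Prop_irrelevance e e'). Qed.

Lemma heq2_eq2 (E : twoCat) (X Y : E) (f f' g g' : hom X Y)
    (s : hom2 f g) (t : hom2 f' g') (e : f = f') (e' : g = g') :
  s ~= t -> eq2 e' \v s = t \v eq2 e.
Proof.
move/(heq2_cast e e') => <-.
by case: f' / e t; case: g' / e' => /=; rewrite vcompl vcompr.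
Qed.

Lemma eq2_heq2 (E : twoCat) (X Y : E) (f f' g g' : hom X Y)
    (s : hom2 f g) (t : hom2 f' g') (e : f = f') (e' : g = g') :
  eq2 e' \v s = t \v eq2 e -> s ~= t.
Proof.
case: f' / e t; case: g' / e' => t; rewrite vcompl vcompr => ->.
by exists erefl, erefl.
Qed.

Lemma heq2_hcompl (E : twoCat) (X Y Z : E) (h h' : @hom E Y Z)
    (f f' g g' : hom X Y) (s : hom2 h h') (t : hom2 f g) (t' : hom2 f' g') :
  t ~= t' -> s \h t ~= s \h t'.
Proof.
move=> [e [e' <-]]; case: f' / e t'; case: g' / e' => t'.
by exists erefl, erefl.
Qed.

Definition iso1 (C : twoCat) (X Y : C) (f : hom X Y) : Prop :=
  exists g : hom Y X, g \c f = id1 X /\ f \c g = id1 Y.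

Definition iso2 (C : twoCat) (X Y : C) (f g : hom X Y) (s : hom2 f g) : Prop :=
  exists t : hom2 g f, t \v s = id2 f /\ s \v t = id2 g.

Record prefunctor (C D : twoCat) := Prefunctor {
  fob :> C -> D;
  fun1 : forall X Y, hom X Y -> hom (fob X) (fob Y);
  fun2 : forall X Y (f g : hom X Y), hom2 f g -> hom2 (fun1 f) (fun1 g);
  fun2_id : forall X Y (f : hom X Y), fun2 (id2 f) = id2 (fun1 f);
  fun2_comp : forall X Y (f g h : hom X Y) (s : hom2 g h) (t : hom2 f g),
    fun2 (s \v t) = fun2 s \v fun2 t
}.
Arguments fun1 {C D} p {X Y}.
Arguments fun2 {C D} p {X Y f g}.

Lemma fun2_eq2 (E E' : twoCat) (G : prefunctor E E') (X Y : E)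
    (f g : hom X Y) (e : f = g) :
  fun2 G (eq2 e) = eq2 (congr1 (fun1 G) e).
Proof. by case: g / e; rewrite fun2_id. Qed.

Record pseudo_struct (C D : twoCat) (F : prefunctor C D) := PseudoStruct {
  hat : forall X Y Z (g : @hom C Y Z) (f : hom X Y),
    hom2 (fun1 F g \c fun1 F f) (fun1 F (g \c f));
  unit2 : forall X : C, hom2 (fun1 F (id1 X)) (id1 (F X));
  hat_iso : forall X Y Z (g : hom Y Z) (f : hom X Y), iso2 (hat g f);
  unit2_iso : forall X, iso2 (unit2 X);
  hat_nat : forall X Y Z (g g' : @hom C Y Z) (f f' : hom X Y)
    (s : hom2 g g') (t : hom2 f f'),
    hat g' f' \v (fun2 F s \h fun2 F t) = fun2 F (s \h t) \v hat g f;
  hat_assoc : forall W X Y Z (h : @hom C Y Z) (g : hom X Y) (f : hom W X),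
    hat h (g \c f) \v (id2 (fun1 F h) \h hat g f)
    ~= hat (h \c g) f \v (hat h g \h id2 (fun1 F f));
  hat_idr : forall X Y (f : @hom C X Y),
    hat f (id1 X) ~= id2 (fun1 F f) \h unit2 X;
  hat_idl : forall X Y (f : @hom C X Y),
    hat (id1 Y) f ~= unit2 Y \h id2 (fun1 F f)
}.
Arguments hat {C D F} p {X Y Z}.
Arguments unit2 {C D F} p.

Record pseudofunctor (C D : twoCat) := Pseudofunctor {
  pre :> prefunctor C D;
  pstr :> pseudo_struct pre
}.

Definition unitary (C D : twoCat) (F : pseudofunctor C D) : Prop :=
  forall X : C, unit2 F X ~= id2 (id1 (F X)).

Record pseudonat (C D : twoCat) (F G : pseudofunctor C D) := Pseudonat {
  xi : forall X : C, hom (F X) (G X);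
  xihat : forall (X Y : C) (f : hom X Y),
    hom2 (fun1 G f \c xi X) (xi Y \c fun1 F f);
  xihat_iso : forall (X Y : C) (f : hom X Y), iso2 (xihat f);
  xihat_nat : forall (X Y : C) (f f' : hom X Y) (t : hom2 f f'),
    xihat f' \v (fun2 G t \h id2 (xi X)) = (id2 (xi Y) \h fun2 F t) \v xihat f;
  xihat_comp : forall (X Y Z : C) (g : hom Y Z) (f : hom X Y),
    xihat (g \c f) \v (hat G g f \h id2 (xi X))
    ~= (id2 (xi Z) \h hat F g f)
       \v eq2 (esym (comp1A (xi Z) (fun1 F g) (fun1 F f)))
       \v (xihat g \h id2 (fun1 F f))
       \v eq2 (comp1A (fun1 G g) (xi Y) (fun1 F f))
       \v (id2 (fun1 G g) \h xihat f);
  xihat_id1 : forall X : C,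
    (id2 (xi X) \h unit2 F X) \v xihat (id1 X) ~= unit2 G X \h id2 (xi X)
}.
Arguments xi {C D F G} p.
Arguments xihat {C D F G} p {X Y}.

Definition pseudonat_iso (C D : twoCat) (F G : pseudofunctor C D)
  (x : pseudonat F G) : Prop := forall X, iso1 (xi x X).

Record linTwoCat (K : comPzRingType) := LinTwoCat {
  lbase :> twoCat;
  hom2_lmod : forall (X Y : lbase) (f g : hom X Y),
    GRing.Lmodule.axioms_ K (hom2 f g);
  hom2M := fun X Y (f g : @hom lbase X Y) =>
    GRing.Lmodule.Pack (hom2_lmod f g) : lmodType K;
  vcomp_linl : forall (X Y : lbase) (f g h : hom X Y) (t : hom2 f g),
    linear (fun s : hom2M g h => s \v t : hom2M f h);
  vcomp_linr : forall (X Y : lbase) (f g h : hom X Y) (s : hom2 g h),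
    linear (fun t : hom2M f g => s \v t : hom2M f h);
  hcomp_linl : forall (X Y Z : lbase) (g g' : hom Y Z) (f f' : hom X Y)
    (t : hom2 f f'),
    linear (fun s : hom2M g g' => s \h t : hom2M (g \c f) (g' \c f'));
  hcomp_linr : forall (X Y Z : lbase) (g g' : hom Y Z) (f f' : hom X Y)
    (s : hom2 g g'),
    linear (fun t : hom2M f f' => s \h t : hom2M (g \c f) (g' \c f'))
}.

HB.instance Definition _ (K : comPzRingType) (C : linTwoCat K) (X Y : C)
  (f g : hom X Y) := GRing.Lmodule.copy (hom2 f g) (hom2M f g).


Section LinearTheory.
Variables (K : comPzRingType) (C : linTwoCat K).

Lemma vcompDl (X Y : C) (f g h : hom X Y) (s s' : hom2 g h) (t : hom2 f g) :
  (s + s') \v t = s \v t + s' \v t.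
Proof. by have := vcomp_linl t 1 s s'; rewrite !scale1r. Qed.

Lemma vcompDr (X Y : C) (f g h : hom X Y) (s : hom2 g h) (t t' : hom2 f g) :
  s \v (t + t') = s \v t + s \v t'.
Proof. by have := vcomp_linr s 1 t t'; rewrite !scale1r. Qed.

Lemma vcomp0l (X Y : C) (f g h : hom X Y) (t : hom2 f g) :
  (0 : hom2 g h) \v t = 0.
Proof. by apply: (@addrI _ (0 \v t)); rewrite -vcompDl !addr0. Qed.

Lemma vcomp0r (X Y : C) (f g h : hom X Y) (s : hom2 g h) :
  s \v (0 : hom2 f g) = 0.
Proof. by apply: (@addrI _ (s \v 0)); rewrite -vcompDr !addr0. Qed.

Lemma vcompZl (X Y : C) (f g h : hom X Y) a (s : hom2 g h) (t : hom2 f g) :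
  (a *: s) \v t = a *: (s \v t).
Proof. by have := vcomp_linl t a s 0; rewrite vcomp0l !addr0. Qed.

Lemma vcompZr (X Y : C) (f g h : hom X Y) a (s : hom2 g h) (t : hom2 f g) :
  s \v (a *: t) = a *: (s \v t).
Proof. by have := vcomp_linr s a t 0; rewrite vcomp0r !addr0. Qed.

Lemma hcompDl (X Y Z : C) (g g' : hom Y Z) (f f' : hom X Y)
    (s s' : hom2 g g') (t : hom2 f f') :
  (s + s') \h t = s \h t + s' \h t.
Proof. by have := hcomp_linl t 1 s s'; rewrite !scale1r. Qed.

Lemma hcompDr (X Y Z : C) (g g' : hom Y Z) (f f' : hom X Y)
    (s : hom2 g g') (t t' : hom2 f f') :
  s \h (t + t') = s \h t + s \h t'.
Proof. by have := hcomp_linr s 1 t t'; rewrite !scale1r. Qed.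

Lemma hcomp0l (X Y Z : C) (g g' : hom Y Z) (f f' : hom X Y) (t : hom2 f f') :
  (0 : hom2 g g') \h t = 0.
Proof. by apply: (@addrI _ (0 \h t)); rewrite -hcompDl !addr0. Qed.

Lemma hcomp0r (X Y Z : C) (g g' : hom Y Z) (f f' : hom X Y) (s : hom2 g g') :
  s \h (0 : hom2 f f') = 0.
Proof. by apply: (@addrI _ (s \h 0)); rewrite -hcompDr !addr0. Qed.

Lemma hcompZl (X Y Z : C) (g g' : hom Y Z) (f f' : hom X Y) a
    (s : hom2 g g') (t : hom2 f f') :
  (a *: s) \h t = a *: (s \h t).
Proof. by have := hcomp_linl t a s 0; rewrite hcomp0l !addr0. Qed.

Lemma hcompZr (X Y Z : C) (g g' : hom Y Z) (f f' : hom X Y) a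
    (s : hom2 g g') (t : hom2 f f') :
  s \h (a *: t) = a *: (s \h t).
Proof. by have := hcomp_linr s a t 0; rewrite hcomp0r !addr0. Qed.

Lemma cast2D (X Y : C) (f f' g g' : hom X Y) (e : f = f') (e' : g = g')
    (s t : hom2 f g) : cast2 e e' (s + t) = cast2 e e' s + cast2 e e' t.
Proof. by case: f' / e; case: g' / e'. Qed.

End LinearTheory.

(* The 2-category C_eps: the pair (s0, s1) stands for s0 + s1 eps.            *)
Section Eps.
Variables (K : comPzRingType) (C : linTwoCat K).

Definition eps_hom2 (X Y : C) (f g : hom X Y) : Type :=
  (hom2 f g * hom2 f g)%type.

Definition eps_id2 (X Y : C) (f : hom X Y) : eps_hom2 f f := (id2 f, 0).

Definition eps_vcomp (X Y : C) (f g h : hom X Y)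
    (s : eps_hom2 g h) (t : eps_hom2 f g) : eps_hom2 f h :=
  (s.1 \v t.1, s.1 \v t.2 + s.2 \v t.1).

Definition eps_hcomp (X Y Z : C) (g g' : hom Y Z) (f f' : hom X Y)
    (s : eps_hom2 g g') (t : eps_hom2 f f') : eps_hom2 (g \c f) (g' \c f') :=
  (s.1 \h t.1, s.1 \h t.2 + s.2 \h t.1).

Lemma eps_heq2 (X Y : C) (f f' g g' : hom X Y)
    (s : eps_hom2 f g) (t : eps_hom2 f' g') :
  (forall e e', cast2 e e' s.1 = t.1 -> cast2 e e' s.2 = t.2) ->
  s.1 ~= t.1 -> s ~= t.
Proof.
move=> st2 [e [e' st1]]; exists e, e'.
move/(_ _ _ st1): st2; move: st1; case: f' / e t => t; case: g' / e' t => t /=.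
by case: s t => [? ?] [? ?] /= -> ->.
Qed.

Lemma eps_vcompA (X Y : C) (f g h k : hom X Y)
    (s : eps_hom2 h k) (t : eps_hom2 g h) (u : eps_hom2 f g) :
  eps_vcomp s (eps_vcomp t u) = eps_vcomp (eps_vcomp s t) u.
Proof.
by rewrite /eps_vcomp /= !vcompDl !vcompDr !vcompA addrA.
Qed.

Lemma eps_vcompl (X Y : C) (f g : hom X Y) (s : eps_hom2 f g) :
  eps_vcomp (eps_id2 g) s = s.
Proof.
by case: s => s0 s1; rewrite /eps_vcomp /= vcomp0l !vcompl addr0.
Qed.

Lemma eps_vcompr (X Y : C) (f g : hom X Y) (s : eps_hom2 f g) :
  eps_vcomp s (eps_id2 f) = s.
Proof.
by case: s => s0 s1; rewrite /eps_vcomp /= vcomp0r !vcompr add0r.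
Qed.

Lemma eps_hcomp_id2 (X Y Z : C) (g : hom Y Z) (f : hom X Y) :
  eps_hcomp (eps_id2 g) (eps_id2 f) = eps_id2 (g \c f).
Proof. by rewrite /eps_hcomp /= hcomp0l hcomp0r addr0 hcomp_id2. Qed.

Lemma eps_interchange (X Y Z : C) (g g' g'' : hom Y Z) (f f' f'' : hom X Y)
    (s' : eps_hom2 g' g'') (s : eps_hom2 g g')
    (t' : eps_hom2 f' f'') (t : eps_hom2 f f') :
  eps_hcomp (eps_vcomp s' s) (eps_vcomp t' t)
  = eps_vcomp (eps_hcomp s' t') (eps_hcomp s t).
Proof.
rewrite /eps_hcomp /eps_vcomp /=.
rewrite !hcompDl !hcompDr !vcompDl !vcompDr !interchange; congr pair.
by rewrite addrACA.
Qed.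

Lemma eps_hcompA (W X Y Z : C) (h h' : hom Y Z) (g g' : hom X Y)
    (f f' : hom W X) (s : eps_hom2 h h') (t : eps_hom2 g g')
    (u : eps_hom2 f f') :
  eps_hcomp s (eps_hcomp t u) ~= eps_hcomp (eps_hcomp s t) u.
Proof.
apply: eps_heq2 => [e e' _|]; last exact: hcompA.
rewrite /= hcompDl hcompDr !cast2D -!addrA.
by congr (_ + (_ + _)); apply/heq2_cast/hcompA.
Qed.

Lemma eps_hcompl (X Y : C) (f g : hom X Y) (s : eps_hom2 f g) :
  eps_hcomp (eps_id2 (id1 Y)) s ~= s.
Proof.
apply: eps_heq2 => [e e' _|]; last exact: hcompl.
by rewrite /= hcomp0l addr0; apply/heq2_cast/hcompl.
Qed.

Lemma eps_hcompr (X Y : C) (f g : hom X Y) (s : eps_hom2 f g) :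
  eps_hcomp s (eps_id2 (id1 X)) ~= s.
Proof.
apply: eps_heq2 => [e e' _|]; last exact: hcompr.
by rewrite /= hcomp0r add0r; apply/heq2_cast/hcompr.
Qed.

Definition eps : twoCat := {|
  ob := C;
  hom := @hom C;
  hom2 := eps_hom2;
  id1 := @id1 C;
  comp1 := @comp1 C;
  id2 := eps_id2;
  vcomp := eps_vcomp;
  hcomp := eps_hcomp;
  comp1A := @comp1A C;
  comp1l := @comp1l C;
  comp1r := @comp1r C;
  vcompA := eps_vcompA;
  vcompl := eps_vcompl;
  vcompr := eps_vcompr;
  hcomp_id2 := eps_hcomp_id2;
  interchange := eps_interchange;
  hcompA := eps_hcompA;
  hcompl := eps_hcompl;
  hcompr := eps_hcompr
|}.

Definition mod_eps (X Y : C) (f g : hom X Y) (s : @hom2 eps X Y f g) :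
  @hom2 C X Y f g := s.1.

End Eps.

Record linPseudofunctor (K : comPzRingType) (C D : linTwoCat K) :=
  LinPseudofunctor {
    lpf :> pseudofunctor C D;
    fun2_lin : forall (X Y : C) (f g : hom X Y),
      linear (fun s : hom2 f g => fun2 lpf s)
  }.

Section Deformations.
Variables (K : comPzRingType) (C D : linTwoCat K) (F : linPseudofunctor C D).

Definition eps_fun2 (X Y : C) (f g : hom X Y) (s : @hom2 (eps C) X Y f g) :
  @hom2 (eps D) (F X) (F Y) (fun1 F f) (fun1 F g) := (fun2 F s.1, fun2 F s.2).

Lemma fun2D (X Y : C) (f g : hom X Y) (s t : hom2 f g) :
  fun2 F (s + t) = fun2 F s + fun2 F t.
Proof. by have := fun2_lin F 1 s t; rewrite !scale1r. Qed.

Lemma fun20 (X Y : C) (f g : hom X Y) : fun2 F (0 : hom2 f g) = 0.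
Proof. by apply: (@addrI _ (fun2 F 0)); rewrite -fun2D !addr0. Qed.

Lemma fun2Z (X Y : C) (f g : hom X Y) a (s : hom2 f g) :
  fun2 F (a *: s) = a *: fun2 F s.
Proof. by have := fun2_lin F a s 0; rewrite fun20 !addr0. Qed.

Lemma eps_fun2_id (X Y : C) (f : hom X Y) :
  eps_fun2 (@id2 (eps C) X Y f) = @id2 (eps D) (F X) (F Y) (fun1 F f).
Proof. by rewrite /eps_fun2 /= fun20 fun2_id. Qed.

Lemma eps_fun2_comp (X Y : C) (f g h : hom X Y)
    (s : @hom2 (eps C) X Y g h) (t : @hom2 (eps C) X Y f g) :
  eps_fun2 (s \v t) = eps_fun2 s \v eps_fun2 t.
Proof. by rewrite /eps_fun2 /= fun2D !fun2_comp. Qed.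

(* The object map and the K[eps]-linear extension of the functors of F. *)
Definition eps_pre : prefunctor (eps C) (eps D) :=
  @Prefunctor (eps C) (eps D) F (fun X Y => @fun1 C D F X Y) eps_fun2
    eps_fun2_id eps_fun2_comp.

Record deformation := Deformation {
  defstr : pseudo_struct eps_pre;
  def_hat : forall (X Y Z : C) (g : hom Y Z) (f : hom X Y),
    mod_eps (hat defstr g f) = hat F g f;
  def_unit2 : forall X : C, mod_eps (unit2 defstr X) = unit2 F X
}.

Definition def_pf (G : deformation) : pseudofunctor (eps C) (eps D) :=
  Pseudofunctor (defstr G).

Definition def_equiv (G G' : deformation) : Prop :=
  exists x : pseudonat (def_pf G) (def_pf G'),
    [/\ pseudonat_iso x,
        forall X : C, xi x X = id1 (F X)
      & forall (X Y : C) (f : hom X Y),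
          mod_eps (xihat x f) ~= id2 (fun1 F f)].

End Deformations.

Section Chains.
Variable C : twoCat.

(* [chain n X Y] : sequences (f_0, ..., f_n) of n.+1 composable 1-morphisms   *)
(* from X to Y, where f_n is applied first.                                   *)
Fixpoint chain (n : nat) (X Y : C) : Type :=
  match n with
  | 0 => hom X Y
  | m.+1 => {Z : C & (hom Z Y * chain m X Z)%type}
  end.

Fixpoint compc (n : nat) (X Y : C) : chain n X Y -> hom X Y :=
  match n return chain n X Y -> hom X Y with
  | 0 => fun f => f
  | m.+1 => fun c => (projT2 c).1 \c compc (projT2 c).2
  end.

(* (f_0, ..., f_n.+1) |-> (f_0, ..., f_i \c f_i.+1, ..., f_n.+1), i <= n      *)
Fixpoint merge (n i : nat) (X Y : C) : chain n.+1 X Y -> chain n X Y :=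
  match n return chain n.+1 X Y -> chain n X Y with
  | 0 => fun c => (projT2 c).1 \c (projT2 c).2
  | m.+1 => fun c =>
      let f0 := (projT2 c).1 in let c' := (projT2 c).2 in
      match i with
      | 0 => existT _ (projT1 c') (f0 \c (projT2 c').1, (projT2 c').2)
      | j.+1 => existT _ (projT1 c) (f0, merge j c')
      end
  end.

(* (f_0, ..., f_n.+1) |-> ((f_0, ..., f_n), f_n.+1)                           *)
Fixpoint unsnoc (n : nat) (X Y : C) :
    chain n.+1 X Y -> {W : C & (chain n W Y * hom X W)%type} :=
  match n return chain n.+1 X Y -> {W : C & (chain n W Y * hom X W)%type} with
  | 0 => fun c => c
  | m.+1 => fun c =>
      let u := unsnoc (projT2 c).2 in
      existT _ (projT1 u)
        (existT _ (projT1 c) ((projT2 c).1, (projT2 u).1), (projT2 u).2)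
  end.

Lemma compc_merge n i (X Y : C) (c : chain n.+1 X Y) :
  compc (merge i c) = compc c.
Proof.
elim: n i X Y c => [|n IHn] [|i] X Y c //=; last by rewrite IHn.
by rewrite comp1A.
Qed.

Lemma compc_unsnoc n (X Y : C) (c : chain n.+1 X Y) :
  compc (projT2 (unsnoc c)).1 \c (projT2 (unsnoc c)).2 = compc c.
Proof. by elim: n X Y c => //= n IHn X Y c; rewrite -comp1A IHn. Qed.

Record cell (X Y : C) := Cell {
  csrc : hom X Y; ctgt : hom X Y; carr : hom2 csrc ctgt }.

Fixpoint cells (n : nat) (X Y : C) : Type :=
  match n with
  | 0 => cell X Y
  | m.+1 => {Z : C & (cell Z Y * cells m X Z)%type}
  end.

Fixpoint srcs (n : nat) (X Y : C) : cells n X Y -> chain n X Y :=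
  match n return cells n X Y -> chain n X Y with
  | 0 => fun s => csrc s
  | m.+1 => fun s =>
      existT _ (projT1 s) (csrc (projT2 s).1, srcs (projT2 s).2)
  end.

Fixpoint tgts (n : nat) (X Y : C) : cells n X Y -> chain n X Y :=
  match n return cells n X Y -> chain n X Y with
  | 0 => fun s => ctgt s
  | m.+1 => fun s =>
      existT _ (projT1 s) (ctgt (projT2 s).1, tgts (projT2 s).2)
  end.

Fixpoint compcs (n : nat) (X Y : C) :
    forall s : cells n X Y, hom2 (compc (srcs s)) (compc (tgts s)) :=
  match n return forall s : cells n X Y,
    hom2 (compc (srcs s)) (compc (tgts s)) with
  | 0 => fun s => carr s
  | m.+1 => fun s => carr (projT2 s).1 \h compcs (projT2 s).2
  end.

End Chains.

Section FChains.
Variables (C D : twoCat) (F : pseudofunctor C D).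

(* F(f_0) \c (F(f_1) \c (... \c F(f_n))) *)
Fixpoint Fcompc (n : nat) (X Y : C) : chain n X Y -> hom (F X) (F Y) :=
  match n return chain n X Y -> hom (F X) (F Y) with
  | 0 => fun f => fun1 F f
  | m.+1 => fun c => fun1 F (projT2 c).1 \c Fcompc (projT2 c).2
  end.

Fixpoint Fcompcs (n : nat) (X Y : C) :
    forall s : cells n X Y, hom2 (Fcompc (srcs s)) (Fcompc (tgts s)) :=
  match n return forall s : cells n X Y,
    hom2 (Fcompc (srcs s)) (Fcompc (tgts s)) with
  | 0 => fun s => fun2 F (carr s)
  | m.+1 => fun s => fun2 F (carr (projT2 s).1) \h Fcompcs (projT2 s).2
  end.

(* 1 \h hat F f_i f_i.+1 \h 1 *)
Fixpoint merge_hat (n i : nat) (X Y : C) :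
    forall c : chain n.+1 X Y, hom2 (Fcompc c) (Fcompc (merge i c)) :=
  match n return forall c : chain n.+1 X Y,
    hom2 (Fcompc c) (Fcompc (merge i c)) with
  | 0 => fun c => hat F (projT2 c).1 (projT2 c).2
  | m.+1 => fun c =>
      match i return hom2 (Fcompc c) (Fcompc (merge i c)) with
      | 0 =>
          (hat F (projT2 c).1 (projT2 (projT2 c).2).1
             \h id2 (Fcompc (projT2 (projT2 c).2).2))
          \v eq2 (comp1A (fun1 F (projT2 c).1)
                    (fun1 F (projT2 (projT2 c).2).1)
                    (Fcompc (projT2 (projT2 c).2).2))
      | j.+1 => id2 (fun1 F (projT2 c).1) \h merge_hat j (projT2 c).2
      end
  end.

Lemma Fcompc_unsnoc n (X Y : C) (c : chain n.+1 X Y) :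
  Fcompc c = Fcompc (projT2 (unsnoc c)).1 \c fun1 F (projT2 (unsnoc c)).2.
Proof. by elim: n X Y c => //= n IHn X Y c; rewrite -comp1A IHn. Qed.

End FChains.

Section Complex.
Variables (K : comPzRingType) (C D : linTwoCat K) (F : linPseudofunctor C D).

(* [cochain n] is X^{n+1}(F). *)
Record cochain (n : nat) := Cochain {
  cofam :> forall (X Y : C) (c : chain n X Y),
    hom2 (Fcompc F c) (fun1 F (compc c));
  cofam_nat : forall (X Y : C) (s : cells n X Y),
    cofam (tgts s) \v Fcompcs F s = fun2 F (compcs s) \v cofam (srcs s)
}.

Lemma cochainP n (p q : cochain n) :
  (forall (X Y : C) (c : chain n X Y), p X Y c = q X Y c) -> p = q.
Proof.
case: p q => [p pn] [q qn] /= pq.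
have {}pq : p = q by do 3 (apply: functional_extensionality_dep => ?).
by case: q / pq qn => qn; rewrite (Prop_irrelevance pn qn).
Qed.

HB.instance Definition _ n := gen_eqMixin (cochain n).
HB.instance Definition _ n := gen_choiceMixin (cochain n).

Program Definition cochain0 n : cochain n := @Cochain n (fun X Y c => 0) _.
Next Obligation. by move=> *; rewrite vcomp0l vcomp0r. Qed.

Program Definition cochainD n (p q : cochain n) : cochain n :=
  @Cochain n (fun X Y c => p X Y c + q X Y c) _.
Next Obligation. by move=> *; rewrite vcompDl vcompDr !cofam_nat. Qed.

Program Definition cochainZ n (a : K) (p : cochain n) : cochain n :=
  @Cochain n (fun X Y c => a *: p X Y c) _.
Next Obligation. by move=> *; rewrite vcompZl vcompZr cofam_nat. Qed.

Definition cochainN n (p : cochain n) : cochain n := cochainZ (-1) p.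

Lemma cochainDA n : associative (@cochainD n).
Proof. by move=> p q r; apply: cochainP => X Y c /=; rewrite addrA. Qed.

Lemma cochainDC n : commutative (@cochainD n).
Proof. by move=> p q; apply: cochainP => X Y c /=; rewrite addrC. Qed.

Lemma cochain0D n : left_id (cochain0 n) (@cochainD n).
Proof. by move=> p; apply: cochainP => X Y c /=; rewrite add0r. Qed.

Lemma cochainND n : left_inverse (cochain0 n) (@cochainN n) (@cochainD n).
Proof. by move=> p; apply: cochainP => X Y c /=; rewrite scaleN1r addNr. Qed.

HB.instance Definition _ n := GRing.isZmodule.Build (cochain n)
  (@cochainDA n) (@cochainDC n) (@cochain0D n) (@cochainND n).

Lemma cochainZA n (a b : K) (p : cochain n) :
  cochainZ a (cochainZ b p) = cochainZ (a * b) p.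
Proof. by apply: cochainP => X Y c /=; rewrite scalerA. Qed.

Lemma cochain1Z n : left_id 1 (@cochainZ n).
Proof. by move=> p; apply: cochainP => X Y c /=; rewrite scale1r. Qed.

Lemma cochainZDr n : right_distributive (@cochainZ n) +%R.
Proof. by move=> a p q; apply: cochainP => X Y c /=; rewrite scalerDr. Qed.

Lemma cochainZDl n (p : cochain n) : {morph (@cochainZ n)^~ p : a b / a + b}.
Proof. by move=> a b; apply: cochainP => X Y c /=; rewrite scalerDl. Qed.

HB.instance Definition _ n := GRing.Zmodule_isLmodule.Build K (cochain n)
  (@cochainZA n) (@cochain1Z n) (@cochainZDr n) (@cochainZDl n).

Definition delta_first n (p : cochain n) (X Y : C) (c : chain n.+1 X Y) :
    hom2 (Fcompc F c) (fun1 F (compc c)) :=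
  hat F (projT2 c).1 (compc (projT2 c).2)
  \v (id2 (fun1 F (projT2 c).1) \h p _ _ (projT2 c).2).

Definition delta_mid n (i : nat) (p : cochain n) (X Y : C)
    (c : chain n.+1 X Y) : hom2 (Fcompc F c) (fun1 F (compc c)) :=
  eq2 (congr1 (fun1 F) (compc_merge i c)) \v (p _ _ (merge i c)
  \v merge_hat F i c).

Definition delta_last_at n (p : cochain n) (X Y : C)
    (u : {W : C & (chain n W Y * hom X W)%type}) :
    hom2 (Fcompc F (projT2 u).1 \c fun1 F (projT2 u).2)
         (fun1 F (compc (projT2 u).1 \c (projT2 u).2)) :=
  hat F (compc (projT2 u).1) (projT2 u).2
  \v (p _ _ (projT2 u).1 \h id2 (fun1 F (projT2 u).2)).

Definition delta_last n (p : cochain n) (X Y : C)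
    (c : chain n.+1 X Y) : hom2 (Fcompc F c) (fun1 F (compc c)) :=
  eq2 (congr1 (fun1 F) (compc_unsnoc c)) \v (delta_last_at p (unsnoc c)
  \v eq2 (Fcompc_unsnoc F c)).

(* With N := n.+2 arguments f_0, ..., f_(n.+1); the summand number i of the   *)
(* middle sum, 0 <= i < N.-1, composes f_i and f_i.+1.                        *)
Definition delta_fam n (p : cochain n) (X Y : C) (c : chain n.+1 X Y) :
    hom2 (Fcompc F c) (fun1 F (compc c)) :=
  delta_first p c
  + \sum_(i < n.+1) (-1) ^+ i.+1 *: delta_mid i p c
  + (-1) ^+ n.+2 *: delta_last p c.

Definition fam_nat n (t : forall (X Y : C) (c : chain n X Y),
    hom2 (Fcompc F c) (fun1 F (compc c))) :=
  forall (X Y : C) (s : cells n X Y),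
    t X Y (tgts s) \v Fcompcs F s = fun2 F (compcs s) \v t X Y (srcs s).

Lemma delta_first_nat n (p : cochain n) : fam_nat (delta_first p).
Proof.
move=> X Y [Z [s0 s]] /=; rewrite /delta_first /=.
rewrite -vcompA -interchange vcompl cofam_nat.
by rewrite vcompA -hat_nat -vcompA -interchange vcompr.
Qed.

Lemma merge_cells n i (X Y : C) (s : cells n.+1 X Y)
    (Q : forall c c' : chain n X Y, hom2 (Fcompc F c) (Fcompc F c') ->
       hom2 (compc c) (compc c') -> Prop) :
  (forall s' : cells n X Y, Q _ _ (Fcompcs F s') (compcs s')) ->
  exists A B, [/\ Q (merge i (srcs s)) (merge i (tgts s)) A B,
    merge_hat F i (tgts s) \v Fcompcs F s = A \v merge_hat F i (srcs s)
    & eq2 (compc_merge i (tgts s)) \v B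
      = compcs s \v eq2 (compc_merge i (srcs s))].
Proof.
elim: n i X Y s Q => [|n IHn] i X Y s Q HQ.
  case: s => Z [s0 s1] /=.
  exists (fun2 F (carr s0 \h carr s1)), (carr s0 \h carr s1); split.
  - exact: (HQ (Cell (carr s0 \h carr s1))).
  - by rewrite hat_nat.
  - by apply: heq2_eq2; exists erefl, erefl.
case: i => [|i].
  case: s => Z [s0 [W [s1 r]]] /=.
  exists (fun2 F (carr s0 \h carr s1) \h Fcompcs F r),
    ((carr s0 \h carr s1) \h compcs r); split.
  - exact: (HQ (existT _ W (Cell (carr s0 \h carr s1), r))).
  - rewrite -[LHS]vcompA (heq2_eq2 (comp1A _ _ _) (comp1A _ _ _) (hcompA _ _ _)).
    rewrite [LHS]vcompA [RHS]vcompA -!interchange vcompl hat_nat.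
    by rewrite vcompr.
  - exact/heq2_eq2/heq2_sym/hcompA.
case: s => Z [s0 s] /=.
have [|A [B [HAB HA HB]]] := IHn i X Z s (fun c c' a b =>
  Q (existT _ Z (csrc s0, c)) (existT _ Z (ctgt s0, c'))
    (fun2 F (carr s0) \h a) (carr s0 \h b)).
  by move=> s'; apply: (HQ (existT _ Z (s0, s'))).
exists (fun2 F (carr s0) \h A), (carr s0 \h B); split=> //.
  by rewrite -!interchange HA vcompl vcompr.
have E f (g g' : @hom C X Z) (e : g = g') (e' : f \c g = f \c g') :
    eq2 e' = id2 f \h eq2 e :> @hom2 C X Y _ _.
  case: g' / e e' => e'; rewrite hcomp_id2.
  exact: (eq2_irr e' erefl).
rewrite !(E _ _ _ (compc_merge i _)) -!interchange HB.
by rewrite vcompl vcompr.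
Qed.

Lemma delta_mid_nat n i (p : cochain n) : fam_nat (delta_mid i p).
Proof.
move=> X Y s; rewrite /delta_mid.
have [|A [B [HQ HA HB]]] := @merge_cells n i X Y s
  (fun c c' a b => p _ _ c' \v a = fun2 F b \v p _ _ c).
  exact: cofam_nat.
rewrite -!fun2_eq2 -!vcompA HA [p _ _ _ \v _]vcompA HQ.
by rewrite !vcompA -!fun2_comp HB.
Qed.

Lemma unsnoc_cells n (X Y : C) (s : cells n.+1 X Y)
    (Q : forall u u' : {W : C & (chain n W Y * hom X W)%type},
       hom2 (Fcompc F (projT2 u).1 \c fun1 F (projT2 u).2)
            (Fcompc F (projT2 u').1 \c fun1 F (projT2 u').2) ->
       hom2 (compc (projT2 u).1 \c (projT2 u).2)
            (compc (projT2 u').1 \c (projT2 u').2) -> Prop) :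
  (forall W (s' : cells n W Y) (f f' : hom X W) (t : hom2 f f'),
     Q (existT _ W (srcs s', f)) (existT _ W (tgts s', f'))
       (Fcompcs F s' \h fun2 F t) (compcs s' \h t)) ->
  exists A B, [/\ Q (unsnoc (srcs s)) (unsnoc (tgts s)) A B,
    eq2 (Fcompc_unsnoc F (tgts s)) \v Fcompcs F s
      = A \v eq2 (Fcompc_unsnoc F (srcs s))
    & eq2 (compc_unsnoc (tgts s)) \v B
      = compcs s \v eq2 (compc_unsnoc (srcs s))].
Proof.
elim: n X Y s Q => [|n IHn] X Y s Q HQ.
  case: s => Z [s0 s1] /=.
  exists (fun2 F (carr s0) \h fun2 F (carr s1)), (carr s0 \h carr s1); split.
  - exact: (HQ Z s0 _ _ (carr s1)).
  - by apply: heq2_eq2; exists erefl, erefl.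
  - by apply: heq2_eq2; exists erefl, erefl.
case: s => Z [s0 s] /=.
have [|A [B [HAB HA HB]]] := IHn X Z s (fun u u' a b => forall a' b',
  fun2 F (carr s0) \h a ~= a' -> carr s0 \h b ~= b' ->
  Q (existT _ (projT1 u) (existT _ Z (csrc s0, (projT2 u).1), (projT2 u).2))
    (existT _ (projT1 u') (existT _ Z (ctgt s0, (projT2 u').1), (projT2 u').2))
    a' b').
  move=> W s' f f' t a' b' Ha' Hb'.
  rewrite -(heq2_uniq (hcompA _ _ _) Ha') -(heq2_uniq (hcompA _ _ _) Hb').
  exact: (HQ W (existT _ Z (s0, s')) f f' t).
exists (cast2 (comp1A _ _ _) (comp1A _ _ _) (fun2 F (carr s0) \h A)).
exists (cast2 (comp1A _ _ _) (comp1A _ _ _) (carr s0 \h B)).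
split.
- by apply: HAB; [exists (comp1A _ _ _), (comp1A _ _ _) ..].
- apply: heq2_eq2; 
  apply: heq2_trans (heq2_hcompl _ (eq2_heq2 HA)) (heq2_cast2 _ _ _).
- apply: heq2_eq2.
  apply: heq2_trans (heq2_sym (heq2_cast2 _ _ _)) (heq2_hcompl _ _).
  exact: eq2_heq2 HB.
Qed.

Lemma delta_last_at_nat n (p : cochain n) (X Y : C) W (s : cells n W Y)
    (f f' : hom X W) (t : hom2 f f') :
  delta_last_at p (existT _ W (tgts s, f')) \v (Fcompcs F s \h fun2 F t)
  = fun2 F (compcs s \h t) \v delta_last_at p (existT _ W (srcs s, f)).
Proof.
rewrite /delta_last_at /= -vcompA -interchange vcompl cofam_nat.
by rewrite vcompA -hat_nat -vcompA -interchange vcompr.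
Qed.

Lemma delta_last_nat n (p : cochain n) : fam_nat (delta_last p).
Proof.
move=> X Y s; rewrite /delta_last.
have [|A [B [HQ HA HB]]] := @unsnoc_cells n X Y s
  (fun u u' a b => delta_last_at p u' \v a = fun2 F b \v delta_last_at p u).
  by move=> W s' f f' t; apply: delta_last_at_nat.
move: (@delta_last_at n p X Y) HQ => d HQ.
rewrite -!fun2_eq2 -!vcompA HA [d _ \v _]vcompA HQ.
by rewrite !vcompA -!fun2_comp HB.
Qed.

Lemma fam_natD n t t' : @fam_nat n t -> fam_nat t' ->
  fam_nat (fun X Y c => t X Y c + t' X Y c).
Proof. by move=> tn tn' X Y s; rewrite vcompDl vcompDr tn tn'. Qed.

Lemma fam_natZ n a t : @fam_nat n t -> fam_nat (fun X Y c => a *: t X Y c).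
Proof. by move=> tn X Y s; rewrite vcompZl vcompZr tn. Qed.

Lemma fam_nat_sum n m (t : nat -> forall (X Y : C) (c : chain n X Y),
    hom2 (Fcompc F c) (fun1 F (compc c))) :
  (forall i, fam_nat (t i)) ->
  fam_nat (fun X Y c => \sum_(i < m) t i X Y c).
Proof.
move=> tn X Y s; elim: m => [|m IHm].
  by rewrite !big_ord0 vcomp0l vcomp0r.
by rewrite !big_ord_recr /= vcompDl vcompDr IHm tn.
Qed.

Lemma delta_nat n (p : cochain n) : fam_nat (delta_fam p).
Proof.
apply: fam_natD; first apply: fam_natD; first exact: delta_first_nat.
  apply: (@fam_nat_sum n.+1 n.+1
    (fun i X Y c => (-1) ^+ i.+1 *: delta_mid i p c)).
  by move=> i; apply/fam_natZ/delta_mid_nat.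
exact/fam_natZ/delta_last_nat.
Qed.

Definition delta n (p : cochain n) : cochain n.+1 := Cochain (delta_nat p).

Lemma delta_linear n : linear (@delta n).
Proof.
move=> a p q; apply: cochainP => X Y c /=; rewrite /delta_fam.
have -> : delta_first (a *: p + q) c = a *: delta_first p c + delta_first q c.
  by rewrite /delta_first hcompDr hcompZr vcompDr vcompZr.
have -> : delta_last (a *: p + q) c = a *: delta_last p c + delta_last q c.
  rewrite /delta_last /delta_last_at hcompDl hcompZl.
  by rewrite !(vcompDl, vcompDr, vcompZl, vcompZr).
under eq_bigr => i _.
  have -> : delta_mid i (a *: p + q) c = a *: delta_mid i p c + delta_mid i q c.
    by rewrite /delta_mid !(vcompDl, vcompDr, vcompZl, vcompZr).
  rewrite scalerDr scalerA mulrC -scalerA; over.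
rewrite big_split /= -scaler_sumr !scalerDr.
rewrite [(-1) ^+ n.+2 *: (a *: _)]scalerA [_ * a]mulrC -scalerA.
by rewrite [X in X + _ = _]addrACA [LHS]addrACA.
Qed.

HB.instance Definition _ n := GRing.isLinear.Build K (cochain n) (cochain n.+1)
  _ (@delta n) (@delta_linear n).

(* X^n(F), with X^0(F) = 0. *)
Definition cplx (n : nat) : lmodType K :=
  match n with 0 => 'rV[K]_0 | m.+1 => cochain m end.

Definition differential (n : nat) : {linear cplx n -> cplx n.+1} :=
  match n return {linear cplx n -> cplx n.+1} with
  | 0 => \0
  | m.+1 => @delta m
  end.

Definition cocycle (n : nat) : Type := {z : cplx n | differential n z = 0}.

Definition coboundary (n : nat) : cplx n -> Prop :=
  match n return cplx n -> Prop with
  | 0 => fun x => x = 0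
  | m.+1 => fun x => exists y : cplx m, x = differential m y
  end.

Definition cohomologous (n : nat) (z z' : cocycle n) : Prop :=
  coboundary (sval z - sval z').

End Complex.

(* The set of classes of the equivalence relation R. *)
Definition classes (T : Type) (R : T -> T -> Prop) : Type :=
  {A : T -> Prop | exists x, A = R x}.

Definition cohomology (K : comPzRingType) (C D : linTwoCat K)
    (F : linPseudofunctor C D) (n : nat) : Type :=
  classes (@cohomologous K C D F n).

Definition deformation_classes (K : comPzRingType) (C D : linTwoCat K)
    (F : linPseudofunctor C D) : Type :=
  classes (@def_equiv K C D F).

(* Main.v *)
(* The first order part of the structure 2-isomorphisms of a deformation is a  *)
(* 2-cochain phi; the associativity coherence says that phi is a cocycle.      *)
(* By unitarity the unit constraint forces F_0^(1)(X) = phi(id_X, id_X), and   *)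
(* then holds for every f because the cocycle identity at (f, id, id) and      *)
(* (id, id, f) gives phi(f, id) = 1 o phi(id, id) and                          *)
(* phi(id, f) = phi(id, id) o 1. So deformations correspond to 2-cocycles. An  *)
(* equivalence is 1 + psi eps for a 1-cochain psi, and its coherence with      *)
(* composition reads phi' = phi + delta psi.                                   *)
From mathcomp Require Import all_boot all_order all_algebra.
From mathcomp Require Import boolp.
Require Import Defs.

Set Implicit Arguments.
Unset Strict Implicit.
Unset Printing Implicit Defensive.

Import GRing.Theory.
Local Open Scope ring_scope.
Local Open Scope twocat_scope.

(** Comparing coefficients of eps turns every axiom of a deformation into an equation on its first
    order part phi. Associativity becomes delta phi = 0 ([delta_eq0P], [def_pentagon]). The unit
    axioms add neither data nor conditions: the first order unit is determined by phi ([unit2_def]),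
    and any cocycle satisfies both unit equations for that choice ([pentagon_unitr],
    [pentagon_unitl]), so every cocycle comes from a deformation ([cocycle_def], [cocycle_defK]).
    Equivalences behave alike: coherence with composition of 1 + psi eps says phi' = phi + delta psi
    ([eps_aut_compP]), and coherence with units then follows ([def_unit2_delta]). Hence equivalent
    means cohomologous ([def_equivP]), and [classes_bijective] passes to classes. *)

Section HeqTheory.

(** * Calculus of equality up to transport, which hides associators and unitors *)

Lemma heq2_refl (T : Type) (H : T -> T -> Type) (f g : T) (s : H f g) : s ~= s.
Proof. by exists erefl, erefl. Qed.

Lemma heq2_eq (T : Type) (H : T -> T -> Type) (f g : T) (s t : H f g) :
  s ~= t -> s = t.
Proof. by move=> st; rewrite (heq2_uniq (heq2_refl s) st). Qed.

Variable E : twoCat.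

Lemma heq2_vcomp (X Y : E) (f f' g g' h h' : hom X Y)
    (s : hom2 g h) (s' : hom2 g' h') (t : hom2 f g) (t' : hom2 f' g') :
  s ~= s' -> t ~= t' -> s \v t ~= s' \v t'.
Proof.
(* The two factors carry separate proofs that the middle 1-morphisms agree; they must be identified
   before transport can be eliminated. *)
move=> [e [e' {s'}<-]] [d [d' {t'}<-]]; rewrite (Prop_irrelevance d' e).
case: g' / e {d'}; case: h' / e'; case: f' / d; exact: heq2_refl.
Qed.

Lemma heq2_hcomp (X Y Z : E) (g0 g0' g1 g1' : @hom E Y Z)
    (f0 f0' f1 f1' : hom X Y) (s : hom2 g0 g1) (s' : hom2 g0' g1')
    (t : hom2 f0 f1) (t' : hom2 f0' f1') :
  s ~= s' -> t ~= t' -> s \h t ~= s' \h t'.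
Proof.
move=> [e [e' {s'}<-]] [d [d' {t'}<-]].
case: g0' / e; case: g1' / e'; case: f0' / d; case: f1' / d'.
exact: heq2_refl.
Qed.

Lemma heq2_id2 (X Y : E) (f g : @hom E X Y) : f = g -> id2 f ~= id2 g.
Proof. by move=> ->; exact: heq2_refl. Qed.

Lemma heq2_vcomp_idl (X Y : E) (f g k l : hom X Y) (u : hom2 g k)
    (s : hom2 f g) : u ~= id2 l -> u \v s ~= s.
Proof.
move=> [d [d' /= ul]]; case: l / d' d ul => d; case: k / d u => u /= ->.
rewrite vcompl; exact: heq2_refl.
Qed.

Lemma heq2_vcomp_idr (X Y : E) (f g h l : hom X Y) (u : hom2 h f)
    (s : hom2 f g) : u ~= id2 l -> s \v u ~= s.
Proof.
move=> [d [d' /= ul]]; case: l / d d' ul => d; case: h / d u => u /= ->.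
rewrite vcompr; exact: heq2_refl.
Qed.

Lemma heq2_hcomp_idl (X Y : E) (f g : hom X Y) (h k : hom Y Y) (u : hom2 h k)
    (s : hom2 f g) : u ~= id2 (id1 Y) -> u \h s ~= s.
Proof.
move=> uE; apply: heq2_trans (hcompl s).
exact: heq2_hcomp uE (heq2_refl s).
Qed.

Lemma heq2_hcomp_idr (X Y : E) (f g : hom X Y) (h k : hom X X) (u : hom2 h k)
    (s : hom2 f g) : u ~= id2 (id1 X) -> s \h u ~= s.
Proof.
move=> uE; apply: heq2_trans (hcompr s).
exact: heq2_hcomp (heq2_refl s) uE.
Qed.

Lemma heq2_hcomp_id2 (X Y Z : E) (g g0 g1 : @hom E Y Z) (f f0 f1 : hom X Y)
    (u : hom2 g0 g1) (v : hom2 f0 f1) :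
  u ~= id2 g -> v ~= id2 f -> u \h v ~= id2 (g \c f).
Proof. by rewrite -hcomp_id2; exact: heq2_hcomp. Qed.

Lemma eq2_id2 (X Y : E) (f g : hom X Y) (e : f = g) : eq2 e ~= id2 f.
Proof. exact/heq2_sym/heq2_cast2. Qed.

Lemma heq2_eq2l (X Y : E) (f g h : hom X Y) (e : g = h) (s : hom2 f g) :
  eq2 e \v s ~= s.
Proof. exact: heq2_vcomp_idl (eq2_id2 e). Qed.

Lemma heq2_eq2r (X Y : E) (f g h : hom X Y) (e : h = f) (s : hom2 f g) :
  s \v eq2 e ~= s.
Proof. exact: heq2_vcomp_idr (eq2_id2 e). Qed.

End HeqTheory.

Lemma heq2_iso2 (E : twoCat) (X Y : E) (f f' g g' : hom X Y)
    (s : hom2 f g) (t : hom2 f' g') : s ~= t -> iso2 s -> iso2 t.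
Proof. by move=> [e [e' {t}<-]]; case: f' / e; case: g' / e'. Qed.

(* Over identity components, the coherence conditions of a pseudonatural       *)
(* transformation lose their associators.                                      *)
Section IdentityComponents.
Variables (E : twoCat) (X Y Z : E).
Variables (xX : hom X X) (xY : hom Y Y) (xZ : hom Z Z).
Hypotheses (xXE : xX = id1 X) (xYE : xY = id1 Y) (xZE : xZ = id1 Z).

Lemma xihat_nat_id1P (f f' : hom X Y) (t : hom2 f f')
    (A : hom2 (f \c xX) (xY \c f)) (A' : hom2 (f' \c xX) (xY \c f'))
    (a : hom2 f f) (a' : hom2 f' f') : A ~= a -> A' ~= a' ->
  A' \v (t \h id2 xX) = (id2 xY \h t) \v A <-> a' \v t = t \v a.
Proof.
move=> Aa Aa'.
have L : A' \v (t \h id2 xX) ~= a' \v t.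
  exact: heq2_vcomp Aa' (heq2_hcomp_idr _ (heq2_id2 xXE)).
have R : (id2 xY \h t) \v A ~= t \v a.
  exact: heq2_vcomp (heq2_hcomp_idl _ (heq2_id2 xYE)) Aa.
split=> e; first by apply: heq2_uniq L _; rewrite e.
apply: heq2_eq; apply: heq2_trans L _; rewrite e; exact: heq2_sym.
Qed.

Lemma xihat_comp_id1P (g : hom Y Z) (f : hom X Y) (k : hom X Z)
    (h h' : hom2 (g \c f) k) (Af : hom2 (f \c xX) (xY \c f))
    (Ag : hom2 (g \c xY) (xZ \c g)) (Ak : hom2 (k \c xX) (xZ \c k))
    (af : hom2 f f) (ag : hom2 g g) (ak : hom2 k k) :
    Af ~= af -> Ag ~= ag -> Ak ~= ak ->
  Ak \v (h' \h id2 xX)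
    ~= (id2 xZ \h h) \v eq2 (esym (comp1A xZ g f)) \v (Ag \h id2 f)
       \v eq2 (comp1A g xY f) \v (id2 g \h Af)
  <-> ak \v h' = h \v (ag \h id2 f) \v (id2 g \h af).
Proof.
move=> Aaf Aag Aak.
have L : Ak \v (h' \h id2 xX) ~= ak \v h'.
  exact: heq2_vcomp Aak (heq2_hcomp_idr _ (heq2_id2 xXE)).
have R : (id2 xZ \h h) \v eq2 (esym (comp1A xZ g f)) \v (Ag \h id2 f)
       \v eq2 (comp1A g xY f) \v (id2 g \h Af)
    ~= h \v (ag \h id2 f) \v (id2 g \h af).
  apply: heq2_vcomp (heq2_hcompl _ Aaf).
  apply: heq2_trans (heq2_eq2r _ _) _.
  apply: heq2_vcomp (heq2_hcomp Aag (heq2_refl _)).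
  apply: heq2_trans (heq2_eq2r _ _) _.
  exact: heq2_hcomp_idl (heq2_id2 xZE).
split=> [e|e].
  apply: heq2_eq; apply: heq2_trans (heq2_sym L) (heq2_trans e R).
apply: heq2_trans L _; rewrite e; exact: heq2_sym.
Qed.

Lemma xihat_id1_id1P (k : hom X X) (u u' : hom2 k (id1 X))
    (A : hom2 (k \c xX) (xX \c k)) (a : hom2 k k) : A ~= a ->
  (id2 xX \h u) \v A ~= u' \h id2 xX <-> u \v a = u'.
Proof.
move=> Aa.
have L : (id2 xX \h u) \v A ~= u \v a.
  exact: heq2_vcomp (heq2_hcomp_idl _ (heq2_id2 xXE)) Aa.
have R : u' \h id2 xX ~= u' by exact: heq2_hcomp_idr (heq2_id2 xXE).
split=> [e|e].
  apply: heq2_eq; apply: heq2_trans (heq2_sym L) (heq2_trans e R).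
apply: heq2_trans L _; rewrite e; exact: heq2_sym.
Qed.

End IdentityComponents.

(** With a, b, c the three terms of the differential of a 1-cochain, the left side is the eps
    coefficient of coherence with composition and the right side is p' = p + delta q. *)
Lemma addr_subP (V : zmodType) (a b c p p' : V) :
  p' + a = b + (c + p) <-> p' = p + (b - a + c).
Proof.
have -> : p + (b - a + c) = b + (c + p) - a.
  by rewrite addrC -!addrA; congr (b + _); rewrite addrC -addrA.
by split=> [/(canRL (addrK _))|->]; rewrite ?subrK.
Qed.

(** * Equality and invertibility of 2-morphisms over the dual numbers *)

Section LinearHeq.
Variables (K : comPzRingType) (C : linTwoCat K).

Lemma heq2D (X Y : C) (f f' g g' : hom X Y) (s t : hom2 f g)
    (s' t' : hom2 f' g') : s ~= s' -> t ~= t' -> s + t ~= s' + t'.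
Proof.
move=> [e [e' {s'}<-]] /(heq2_cast e e') {t'}<-.
case: f' / e; case: g' / e'; exact: heq2_refl.
Qed.

Lemma heq2_addIr (X Y : C) (f f' g g' : hom X Y) (s t : hom2 f g)
    (s' t' : hom2 f' g') : s + t ~= s' + t' -> t ~= t' -> s ~= s'.
Proof.
move=> [e [e' st]] /(heq2_cast e e') tE; exists e, e'; apply: (@addIr _ t').
by rewrite -{1}tE -cast2D.
Qed.

(** Proofs of equality of 1-morphisms are irrelevant, so both coefficients can share one
    transport. *)
Lemma heq2_epsP (X Y : C) (f f' g g' : hom X Y)
    (s : @hom2 (eps C) X Y f g) (t : @hom2 (eps C) X Y f' g') :
  s ~= t <-> s.1 ~= t.1 /\ s.2 ~= t.2.
Proof.
split; last first.
  by case=> st1 st2; apply: eps_heq2 => // e e' _; exact: heq2_cast.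
case=> [e [e' {t}<-]]; case: f' / e; case: g' / e'.
by split; exact: heq2_refl.
Qed.

Lemma eps_iso2 (X Y : C) (f g : hom X Y) (s : @hom2 (eps C) X Y f g) :
  iso2 s.1 -> iso2 s.
Proof.
case: s => s0 s1 /= [t [ts st]].
(* The geometric series for the inverse of s0 + s1 eps stops after first order because eps squared
   is 0. *)
exists (t, - (t \v (s1 \v t))); rewrite /= /eps_vcomp /eps_id2 /=.
rewrite ts st -!scaleN1r vcompZl vcompZr !vcompA st vcompl -!vcompA ts vcompr.
by rewrite !scaleN1r subrr addNr.
Qed.

End LinearHeq.

(** * The cocycle condition in degree two *)

Section Deformations.
Variables (K : comPzRingType) (C D : linTwoCat K) (F : linPseudofunctor C D).

Definition chain2 (X Y Z : C) (g : hom Y Z) (f : hom X Y) : chain 1 X Z :=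
  existT _ Y (g, f).

Definition chain3 (W X Y Z : C) (h : hom Y Z) (g : hom X Y) (f : hom W X) :
  chain 2 W Z := existT _ Y (h, chain2 g f).

(** The 2-cocycle identity with its negative terms moved to the right. In this form it is exactly
    the eps coefficient of [hat_assoc]. *)
Definition pentagon (p : cochain F 1) : Prop :=
  forall (W X Y Z : C) (h : hom Y Z) (g : hom X Y) (f : hom W X),
    hat F h (g \c f) \v (id2 (fun1 F h) \h p _ _ (chain2 g f))
      + p _ _ (chain2 h (g \c f)) \v (id2 (fun1 F h) \h hat F g f)
    ~= hat F (h \c g) f \v (p _ _ (chain2 h g) \h id2 (fun1 F f))
      + p _ _ (chain2 (h \c g) f) \v (hat F h g \h id2 (fun1 F f)).

Lemma delta_eq0P (p : cochain F 1) : delta p = 0 <-> pentagon p.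
Proof.
(* On three arguments the signs alternate as +, -, +, -; [delta_mid] counts from 0, so [delta_mid 0]
   is negative and [delta_mid 1] positive. *)
have E W X Y Z (h : hom Y Z) (g : hom X Y) (f : hom W X) :
    delta p _ _ (chain3 h g f)
    = (delta_first p (chain3 h g f) + delta_mid 1 p (chain3 h g f))
      - (delta_last p (chain3 h g f) + delta_mid 0 p (chain3 h g f)).
  rewrite /= /delta_fam !big_ord_recr big_ord0 /= add0r.
  rewrite !exprS expr0 !mulr1 mulN1r opprK !scaleN1r scale1r mulN1r scaleN1r.
  by rewrite opprD -!addrA; congr (_ + _); rewrite addrC -!addrA; congr (_ + _).
have L W X Y Z (h : hom Y Z) (g : hom X Y) (f : hom W X) :
  delta_first p (chain3 h g f) + delta_mid 1 p (chain3 h g f) ~=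
    hat F h (g \c f) \v (id2 (fun1 F h) \h p _ _ (chain2 g f))
      + p _ _ (chain2 h (g \c f)) \v (id2 (fun1 F h) \h hat F g f).
  by apply: heq2D; [exact: heq2_refl | exact: heq2_eq2l].
have R W X Y Z (h : hom Y Z) (g : hom X Y) (f : hom W X) :
  delta_last p (chain3 h g f) + delta_mid 0 p (chain3 h g f) ~=
    hat F (h \c g) f \v (p _ _ (chain2 h g) \h id2 (fun1 F f))
      + p _ _ (chain2 (h \c g) f) \v (hat F h g \h id2 (fun1 F f)).
  apply: heq2D.
    exact: heq2_trans (heq2_eq2l _ _) (heq2_eq2r _ _).
  apply: heq2_trans (heq2_eq2l _ _) (heq2_vcomp (heq2_refl _) _).
  exact: heq2_eq2r.
split=> [d0 W X Y Z h g f|pP].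
  apply: heq2_trans (heq2_sym (L _ _ _ _ h g f)) _.
  apply: heq2_trans (R _ _ _ _ h g f).
  suff -> : delta_first p (chain3 h g f) + delta_mid 1 p (chain3 h g f)
    = delta_last p (chain3 h g f) + delta_mid 0 p (chain3 h g f).
    exact: heq2_refl.
  by apply/eqP; rewrite -subr_eq0 -E d0.
apply: cochainP => W Z [Y [h [X [g f]]]].
rewrite (E W X Y Z h g f); apply/eqP; rewrite subr_eq0; apply/eqP/heq2_eq.
apply: heq2_trans (L _ _ _ _ h g f) _.
apply: heq2_trans (pP _ _ _ _ h g f) (heq2_sym (R _ _ _ _ h g f)).
Qed.

Lemma delta_cochain0E (q : cochain F 0) (X Y Z : C) (g : hom Y Z)
    (f : hom X Y) :
  delta q _ _ (chain2 g f)
  = hat F g f \v (id2 (fun1 F g) \h q _ _ f) - q _ _ (g \c f) \v hat F g f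
    + hat F g f \v (q _ _ g \h id2 (fun1 F f)).
Proof.
rewrite /= /delta_fam big_ord_recr big_ord0 /= add0r.
rewrite !exprS expr0 !mulr1 mulN1r opprK scaleN1r scale1r.
congr (_ - _ + _).
  exact: heq2_eq (heq2_eq2l _ _).
exact: heq2_eq (heq2_trans (heq2_eq2l _ _) (heq2_eq2r _ _)).
Qed.

(** * From a deformation to a 2-cocycle *)

Section OfDeformation.
Variable G : deformation F.

Definition def_fam (X Y : C) (c : chain 1 X Y) :
    hom2 (Fcompc F c) (fun1 F (compc c)) :=
  (hat (defstr G) (projT2 c).1 (projT2 c).2).2.

Lemma def_hatE (X Y Z : C) (g : hom Y Z) (f : hom X Y) :
  hat (defstr G) g f = (hat F g f, def_fam (chain2 g f)).
Proof. by rewrite -(def_hat G); exact: surjective_pairing. Qed.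

Lemma def_fam_nat : fam_nat def_fam.
Proof.
move=> X Z [Y [s t]] /=.
(* Naturality is tested on 2-morphisms without eps part, so that the eps coefficient involves the
   first order part of the structure alone. *)
have := hat_nat (defstr G) ((carr s, 0) : @hom2 (eps C) _ _ _ _)
  ((carr t, 0) : @hom2 (eps C) _ _ _ _).
rewrite !def_hatE => /(congr1 snd) /=.
by rewrite !fun20 !(hcomp0l, hcomp0r, addr0, fun20, vcomp0r, vcomp0l, add0r).
Qed.

Definition def_cochain : cochain F 1 := Cochain def_fam_nat.

Lemma def_pentagon : pentagon def_cochain.
Proof.
move=> W X Y Z h g f.
have /(@heq2_epsP K D)[_] := hat_assoc (defstr G) h g f.
by rewrite !def_hatE /= !(hcomp0l, hcomp0r, addr0, add0r).
Qed.

Definition def_cocycle : cocycle F 2 :=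
  exist (fun z : cplx F 2 => differential F 2 z = 0) def_cochain
    ((delta_eq0P def_cochain).2 def_pentagon).

Hypothesis F_unitary : unitary F.

(** This is the eps coefficient of [hat_idr] at the identity 1-morphism, where unitarity turns
    whiskering by [fun1 F (id1 X)] into whiskering by an identity. *)
Lemma unit2_def (X : C) :
  (unit2 (defstr G) X).2 ~= def_cochain _ _ (chain2 (id1 X) (id1 X)).
Proof.
have /(@heq2_epsP K D)[_] := hat_idr (defstr G) (id1 X).
rewrite def_hatE /= hcomp0l addr0 => pE.
apply: heq2_sym; apply: heq2_trans pE (heq2_hcomp_idl _ _).
by case: (F_unitary X) => e _; exact: heq2_id2.
Qed.

Lemma def_unit2E (X : C) : (unit2 (defstr G) X).1 = unit2 F X.
Proof. exact: def_unit2. Qed.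

End OfDeformation.

Lemma heq2_cochain (p : cochain F 1) (X Y Z : C) (g g' : hom Y Z)
    (f f' : hom X Y) :
  g = g' -> f = f' -> p _ _ (chain2 g f) ~= p _ _ (chain2 g' f').
Proof. by move=> -> ->; exact: heq2_refl. Qed.

(** * From a 2-cocycle to a deformation *)

Section OfCocycle.
Hypothesis F_unitary : unitary F.

Lemma unitary_fun1 (X : C) : fun1 F (id1 X) = id1 (F X).
Proof. by case: (F_unitary X). Qed.

Lemma id2_fun1 (X : C) : id2 (fun1 F (id1 X)) ~= id2 (id1 (F X)).
Proof. exact/heq2_id2/unitary_fun1. Qed.

(** The argument [g] is only propositionally an identity, so that the lemma also covers
    [id1 X \c id1 X]. *)
Lemma hat_unitr (X Y : C) (f : hom X Y) (g : hom X X) :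
  g = id1 X -> hat F f g ~= id2 (fun1 F f).
Proof.
move=> ->; apply: heq2_trans (hat_idr _ _) _.
exact: heq2_hcomp_idr (F_unitary X).
Qed.

Lemma hat_unitl (X Y : C) (f : hom X Y) (g : hom Y Y) :
  g = id1 Y -> hat F g f ~= id2 (fun1 F f).
Proof.
move=> ->; apply: heq2_trans (hat_idl _ _) _.
exact: heq2_hcomp_idl (F_unitary Y).
Qed.

Variable p : cochain F 1.
Hypothesis pP : pentagon p.

(** In the cocycle identity at (f, id, id), unitarity reduces three of the four terms to p(f, id);
    the first stays 1 o p(id, id). Cancelling one p(f, id) on each side leaves the claim. *)
Lemma pentagon_unitr (X Y : C) (f : hom X Y) :
  p _ _ (chain2 f (id1 X))
  ~= id2 (fun1 F f) \h p _ _ (chain2 (id1 X) (id1 X)).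
Proof.
have T1 := heq2_vcomp_idl (id2 (fun1 F f) \h p _ _ (chain2 (id1 X) (id1 X)))
  (hat_unitr f (comp1l (id1 X))).
have T2 : p _ _ (chain2 f (id1 X \c id1 X))
    \v (id2 (fun1 F f) \h hat F (id1 X) (id1 X)) ~= p _ _ (chain2 f (id1 X)).
  apply: heq2_trans (heq2_vcomp_idr _ _) (heq2_cochain _ _ (comp1l _)) => //.
  exact: heq2_hcomp_id2 (heq2_refl _) (hat_unitr _ _).
have T3 : hat F (f \c id1 X) (id1 X)
    \v (p _ _ (chain2 f (id1 X)) \h id2 (fun1 F (id1 X)))
    ~= p _ _ (chain2 f (id1 X)).
  apply: heq2_trans (heq2_vcomp_idl _ (hat_unitr _ _)) _ => //.
  exact: heq2_hcomp_idr (id2_fun1 X).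
have T4 : p _ _ (chain2 (f \c id1 X) (id1 X))
    \v (hat F f (id1 X) \h id2 (fun1 F (id1 X))) ~= p _ _ (chain2 f (id1 X)).
  apply: heq2_trans (heq2_vcomp_idr _ _) (heq2_cochain _ (comp1r _) _) => //.
  exact: heq2_hcomp_id2 (hat_unitr _ _) (heq2_refl _).
have T13 := heq2_addIr (pP f (id1 X) (id1 X)) (heq2_trans T2 (heq2_sym T4)).
exact: heq2_trans (heq2_sym T3) (heq2_trans (heq2_sym T13) T1).
Qed.

(** The mirror argument at (id, id, f): here it is the third term that stays p(id, id) o 1. *)
Lemma pentagon_unitl (X Y : C) (f : hom X Y) :
  p _ _ (chain2 (id1 Y) f)
  ~= p _ _ (chain2 (id1 Y) (id1 Y)) \h id2 (fun1 F f).
Proof.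
have T1 : hat F (id1 Y) (id1 Y \c f)
    \v (id2 (fun1 F (id1 Y)) \h p _ _ (chain2 (id1 Y) f))
    ~= p _ _ (chain2 (id1 Y) f).
  apply: heq2_trans (heq2_vcomp_idl _ (hat_unitl _ _)) _ => //.
  exact: heq2_hcomp_idl (id2_fun1 Y).
have T2 : p _ _ (chain2 (id1 Y) (id1 Y \c f))
    \v (id2 (fun1 F (id1 Y)) \h hat F (id1 Y) f) ~= p _ _ (chain2 (id1 Y) f).
  apply: heq2_trans (heq2_vcomp_idr _ _) (heq2_cochain _ _ (comp1l _)) => //.
  exact: heq2_hcomp_id2 (heq2_refl _) (hat_unitl _ _).
have T3 := heq2_vcomp_idl (p _ _ (chain2 (id1 Y) (id1 Y)) \h id2 (fun1 F f))
  (hat_unitl f (comp1l (id1 Y))).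
have T4 : p _ _ (chain2 (id1 Y \c id1 Y) f)
    \v (hat F (id1 Y) (id1 Y) \h id2 (fun1 F f)) ~= p _ _ (chain2 (id1 Y) f).
  apply: heq2_trans (heq2_vcomp_idr _ _) (heq2_cochain _ (comp1r _) _) => //.
  exact: heq2_hcomp_id2 (hat_unitl _ _) (heq2_refl _).
have T13 := heq2_addIr (pP (id1 Y) (id1 Y) f) (heq2_trans T2 (heq2_sym T4)).
exact: heq2_trans (heq2_sym T1) (heq2_trans T13 T3).
Qed.

Lemma fun1_id1_comp (X : C) :
  fun1 F (id1 X) \c fun1 F (id1 X) = fun1 F (id1 X).
Proof. by rewrite {1}unitary_fun1 comp1l. Qed.

Lemma fun1_id1_comp_id1 (X : C) : fun1 F (id1 X \c id1 X) = id1 (F X).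
Proof. by rewrite comp1l unitary_fun1. Qed.

Definition cocycle_hat (X Y Z : C) (g : hom Y Z) (f : hom X Y) :
    @hom2 (eps D) (F X) (F Z) (fun1 F g \c fun1 F f) (fun1 F (g \c f)) :=
  (hat F g f, p _ _ (chain2 g f)).

(** The eps coefficient is the one forced by [unit2_def]; the cast is available because unitarity
    gives F(id) = id. *)
Definition cocycle_unit2 (X : C) :
    @hom2 (eps D) (F X) (F X) (fun1 F (id1 X)) (id1 (F X)) :=
  (unit2 F X, cast2 (fun1_id1_comp X) (fun1_id1_comp_id1 X)
                (p _ _ (chain2 (id1 X) (id1 X)))).

Lemma cocycle_unit2E (X : C) :
  (cocycle_unit2 X).2 ~= p _ _ (chain2 (id1 X) (id1 X)).
Proof. exact/heq2_sym/heq2_cast2. Qed.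

Lemma cocycle_hat_nat (X Y Z : C) (g g' : @hom (eps C) Y Z)
    (f f' : @hom (eps C) X Y) (s : hom2 g g') (t : hom2 f f') :
  cocycle_hat g' f' \v (fun2 (eps_pre F) s \h fun2 (eps_pre F) t)
  = fun2 (eps_pre F) (s \h t) \v cocycle_hat g f.
Proof.
congr pair; first exact: hat_nat.
(* The terms with an eps part of [s] or [t] match by naturality of [hat F]; the remaining one is
   naturality of the cochain. *)
rewrite /= vcompDr !hat_nat fun2D vcompDl addrC; congr (_ + _).
exact: (cofam_nat p (existT _ Y (Cell s.1, Cell t.1))).
Qed.

Definition cocycle_struct : pseudo_struct (eps_pre F).
Proof.
refine (@PseudoStruct (eps C) (eps D) (eps_pre F) cocycle_hat cocycle_unit2
  _ _ _ _ _ _).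
- by move=> X Y Z g f; apply: (@eps_iso2 K D); exact: hat_iso.
- by move=> X; apply: (@eps_iso2 K D); exact: unit2_iso.
- exact: cocycle_hat_nat.
- move=> W X Y Z h g f; apply/(@heq2_epsP K D); split; first exact: hat_assoc.
  by rewrite /= !(hcomp0l, hcomp0r, addr0, add0r); exact: pP.
- move=> X Y f; apply/(@heq2_epsP K D); split; first exact: hat_idr.
  rewrite /= hcomp0l addr0; apply: heq2_trans (pentagon_unitr f) _.
  exact: heq2_hcomp (heq2_refl _) (heq2_sym (cocycle_unit2E X)).
- move=> X Y f; apply/(@heq2_epsP K D); split; first exact: hat_idl.
  rewrite /= hcomp0r add0r; apply: heq2_trans (pentagon_unitl f) _.
  exact: heq2_hcomp (heq2_sym (cocycle_unit2E Y)) (heq2_refl _).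
Defined.

Definition cocycle_def : deformation F :=
  @Deformation K C D F cocycle_struct
    (fun X Y Z g f => erefl) (fun X => erefl).

Lemma cocycle_defK : def_cochain cocycle_def = p.
Proof. by apply: cochainP => X Z [Y [g f]]. Qed.

End OfCocycle.

(** * Equivalences of deformations and coboundaries *)

Definition eps_aut (q : cochain F 0) (X Y : C) (f : hom X Y) :
    @hom2 (eps D) (F X) (F Y) (fun1 F f) (fun1 F f) :=
  (id2 (fun1 F f), q _ _ f).

Lemma eps_aut_nat (q : cochain F 0) (X Y : C) (f f' : @hom (eps C) X Y)
    (t : hom2 f f') :
  eps_aut q f' \v fun2 (eps_pre F) t = fun2 (eps_pre F) t \v eps_aut q f.
Proof.
congr pair; rewrite /= ?vcompl ?vcompr // addrC; congr (_ + _).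
exact: (cofam_nat q (Cell t.1 : cells 0 X Y)).
Qed.

Section Equivalence.
Variables G G' : deformation F.

(** The order zero coefficients of both sides are [hat F g f], so only the eps coefficients carry a
    condition, and [addr_subP] rearranges it. *)
Lemma eps_aut_compP (q : cochain F 0) (X Y Z : C) (g : hom Y Z)
    (f : hom X Y) :
  eps_aut q (g \c f) \v hat (defstr G') g f
    = hat (defstr G) g f
      \v (eps_aut q g \h @id2 (eps D) (F X) (F Y) (fun1 F f))
      \v (@id2 (eps D) (F Y) (F Z) (fun1 F g) \h eps_aut q f)
  <-> def_cochain G' _ _ (chain2 g f)
      = def_cochain G _ _ (chain2 g f) + delta q _ _ (chain2 g f).
Proof.
rewrite !def_hatE delta_cochain0E /=.
rewrite [X in X = _ <-> _]/eps_vcomp [X in _ = X <-> _]/eps_vcomp /=.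
rewrite !(hcomp0l, hcomp0r, addr0, add0r) !hcomp_id2 !vcompr !vcompl.
set a := q _ _ (g \c f) \v _; set b := hat F g f \v (_ \h q _ _ f).
set c := hat F g f \v (q _ _ g \h _).
set p := def_fam G _; set p' := def_fam G' _.
split=> [[/addr_subP]|/addr_subP pE] //.
by congr pair.
Qed.

(** By unitarity each of the three terms reduces to q(id), and q(id) - q(id) + q(id) = q(id). *)
Lemma delta_cochain0_id1 (q : cochain F 0) (X : C) : unitary F ->
  delta q _ _ (chain2 (id1 X) (id1 X)) ~= q _ _ (id1 X).
Proof.
move=> F_unitary; rewrite delta_cochain0E.
have idE := id2_fun1 F_unitary X.
have hatE := hat_unitl F_unitary (id1 X) erefl.
have q1 : hat F (id1 X) (id1 X) \v (id2 (fun1 F (id1 X)) \h q _ _ (id1 X))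
    ~= q _ _ (id1 X).
  exact: heq2_trans (heq2_vcomp_idl _ hatE) (heq2_hcomp_idl _ idE).
have q2 : q _ _ (id1 X \c id1 X) \v hat F (id1 X) (id1 X) ~= q _ _ (id1 X).
  apply: heq2_trans (heq2_vcomp_idr _ hatE) _.
  rewrite comp1l; exact: heq2_refl.
rewrite (heq2_uniq (heq2_sym q1) (heq2_sym q2)) subrr add0r.
exact: heq2_trans (heq2_vcomp_idl _ hatE) (heq2_hcomp_idr _ idE).
Qed.

(** This is the eps coefficient of coherence with units. Both first order units are values of the
    cochains at (id, id), and these differ there by (delta q)(id, id) = q(id). *)
Lemma def_unit2_delta (q : cochain F 0) (X : C) :
    unitary F -> def_cochain G' = def_cochain G + delta q ->
  unit2 F X \v q _ _ (id1 X) + (unit2 (defstr G) X).2 \v id2 (fun1 F (id1 X))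
  = (unit2 (defstr G') X).2.
Proof.
move=> F_unitary pE; apply: heq2_eq.
rewrite vcompr addrC.
apply: heq2_trans (heq2_sym (unit2_def G' F_unitary X)); rewrite pE.
apply: heq2D.
  exact: unit2_def.
apply: heq2_trans (heq2_vcomp_idl _ (F_unitary X)) (heq2_sym _).
exact: delta_cochain0_id1.
Qed.

Lemma def_equiv_delta (q : cochain F 0) :
  unitary F -> def_cochain G' = def_cochain G + delta q -> def_equiv G G'.
Proof.
move=> F_unitary pE.
(* The component 1 + q eps, moved from F f to the endpoints F f o id and id o F f that a
   pseudonatural transformation prescribes. *)
pose A X Y (f : @hom C X Y) :
    @hom2 (eps D) (F X) (F Y) (fun1 F f \c id1 (F X)) (id1 (F Y) \c fun1 F f) :=
  cast2 (esym (comp1r (fun1 F f))) (esym (comp1l (fun1 F f))) (eps_aut q f).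
have AE X Y (f : @hom C X Y) : A X Y f ~= eps_aut q f.
  exact/heq2_sym/heq2_cast2.
have A_iso X Y (f : @hom C X Y) : iso2 (A X Y f).
  apply: (@heq2_iso2 (eps D) _ _ _ _ _ _ _ _ (heq2_sym (AE X Y f))).
  apply: (@eps_iso2 K D).
  by exists (id2 (fun1 F f)); rewrite vcompl.
have A_nat X Y (f f' : @hom (eps C) X Y) (t : hom2 f f') :
    A X Y f' \v (fun2 (eps_pre F) t \h @id2 (eps D) _ _ (id1 (F X)))
    = (@id2 (eps D) _ _ (id1 (F Y)) \h fun2 (eps_pre F) t) \v A X Y f.
  apply/(@xihat_nat_id1P (eps D) _ _ _ _ erefl erefl _ _ _ _ _ _ _
    (AE X Y f) (AE X Y f')).
  exact: eps_aut_nat.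
refine (ex_intro _ (@Pseudonat (eps C) (eps D) (def_pf G) (def_pf G')
  (fun X => id1 (F X)) A A_iso A_nat _ _) _).
Unshelve.
- split=> // [X|X Y f].
    by exists (id1 (F X)); rewrite /= comp1l.
  by case/(@heq2_epsP K D): (AE X Y f).
- move=> X Y Z g f.
  refine (proj2 (@xihat_comp_id1P (eps D) _ _ _ _ _ _ erefl erefl _ _ _
    (hat (defstr G) g f) (hat (defstr G') g f) _ _ _
    _ _ _ (AE X Y f) (AE Y Z g) (AE X Z (g \c f))) _).
  by apply/eps_aut_compP; rewrite pE.
- move=> X.
  apply/(@xihat_id1_id1P (eps D) _ _ erefl _ _ _ _ _ (AE X X (id1 X))).
  apply: injective_projections; first by rewrite /= !def_unit2E vcompr.
  by rewrite /= def_unit2E; exact: def_unit2_delta.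
Qed.

Lemma delta_def_equiv : def_equiv G G' ->
  exists q : cochain F 0, def_cochain G' = def_cochain G + delta q.
Proof.
case=> x [_ x1 x2].
have u X Y (f : @hom C X Y) : fun1 F f \c xi x X = fun1 F f.
  by rewrite x1 comp1r.
have v X Y (f : @hom C X Y) : xi x Y \c fun1 F f = fun1 F f.
  by rewrite x1 comp1l.
(* Identity components allow the eps part of [xihat x f] to be read as an endomorphism of F f. *)
pose q X Y (f : chain 0 X Y) : hom2 (Fcompc F f) (fun1 F (compc f)) :=
  cast2 (u X Y f) (v X Y f) (xihat x f).2.
have xE X Y (f : @hom C X Y) :
    xihat x f ~= ((id2 (fun1 F f), q X Y f) : @hom2 (eps D) (F X) (F Y) _ _).
  apply/(@heq2_epsP K D); split; first exact: x2.
  exact: heq2_cast2.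
have q_nat : fam_nat q.
  move=> X Y s.
  have := xihat_nat x ((carr s, 0) : @hom2 (eps C) _ _ _ _).
  move/(xihat_nat_id1P (x1 X) (x1 Y) _ (xE X Y (csrc s)) (xE X Y (ctgt s))).
  move/(congr1 snd).
  by rewrite /= fun20 vcomp0r vcomp0l add0r addr0.
exists (Cochain q_nat); apply: cochainP => X Z [Y [g f]].
apply/eps_aut_compP.
refine (proj1 (xihat_comp_id1P (x1 X) (x1 Z) _ _ (xE X Y f) (xE Y Z g)
  (xE X Z (g \c f))) _).
exact: (xihat_comp x g f).
Qed.

Lemma def_equivP : unitary F ->
  def_equiv G G' <-> cohomologous (def_cocycle G) (def_cocycle G').
Proof.
move=> F_unitary; split=> [/delta_def_equiv [q pE]|[q pE]].
  (* [cohomologous] subtracts the second cocycle from the first, whereas [delta q] is second minus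
     first; hence the sign. *)
  by exists (- q : cochain F 0); rewrite /= pE linearN opprD addrA subrr add0r.
have {}pE : def_cochain G - def_cochain G' = delta (q : cochain F 0) := pE.
apply: (@def_equiv_delta (- (q : cochain F 0))) => //.
have -> : delta (- (q : cochain F 0)) = - (def_cochain G - def_cochain G').
  by rewrite pE linearN.
by rewrite opprB addrC subrK.
Qed.

End Equivalence.
End Deformations.

(** A class is a predicate, so precomposition with [m'] and with [m] transports classes both ways.
    Although [m'] is only a right inverse of [m], the point m'(m x) satisfies the same classes as x,
    because [R] is tested after applying [m]. *)
Lemma classes_bijective (T T' : Type) (R : T -> T -> Prop)
    (R' : T' -> T' -> Prop) (m : T -> T') (m' : T' -> T) :
    cancel m' m -> (forall x y, R x y <-> R' (m x) (m y)) ->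
  exists b : classes R -> classes R', bijective b.
Proof.
move=> m'K mR.
have fwd (A : classes R) : exists y, (fun y => sval A (m' y)) = R' y.
  case: A => A [x /= ->]; exists (m x); apply/funext => y; apply/propext.
  by rewrite mR m'K.
have bwd (A : classes R') : exists x, (fun x => sval A (m x)) = R x.
  case: A => A [y /= ->]; exists (m' y); apply/funext => x; apply/propext.
  by rewrite mR m'K.
exists (fun A => exist (fun B => exists y, B = R' y) _ (fwd A)).
exists (fun A => exist (fun B => exists x, B = R x) _ (bwd A)) => A.
  apply: eq_sig_hprop => [?|]; first exact: Prop_irrelevance.
  apply/funext => x /=.
  have [x0 ->] := svalP A.
  by apply/propext; rewrite !mR m'K.
apply: eq_sig_hprop => [?|]; first exact: Prop_irrelevance.
by apply/funext => y /=; rewrite m'K.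
Qed.

Theorem theorem6p2 (K : comPzRingType) (C D : linTwoCat K)
    (F : linPseudofunctor C D) (F_unitary : unitary F) :
  exists b : deformation_classes F -> cohomology F 2, bijective b.
Proof.
pose m' (z : cocycle F 2) :=
  cocycle_def F_unitary ((delta_eq0P (sval z)).1 (svalP z)).
apply: (@classes_bijective _ _ _ _ (@def_cocycle K C D F) m') => [z|G G'].
  apply: eq_sig_hprop => [?|]; first exact: Prop_irrelevance.
  exact: cocycle_defK.
exact: def_equivP.
Qed.
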